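(* Let $l\ge1$ be an integer and let $P\subset\mathbb R^d$ be a lattice polytope with $I_l(P)\neq\emptyset$. Then there is $\mathbf w\in I_l(P)$ with $$\mathrm{ca}(\mathbf w,P)\le 8d\cdot(8l+7)^{2^{2d+1}}-1.$$
   Context: A lattice polytope is a convex polytope whose vertices lie in $\mathbb Z^d$. $I_l(P)=\mathrm{int}(P)\cap l\mathbb Z^d$ is the set of interior points of $P$ all of whose coordinates are integers divisible by $l$. For $\mathbf w\in\mathrm{int}(P)$, the coefficient of asymmetry is $\mathrm{ca}(\mathbf w,P)=\max_{|\mathbf y|=1}\dfrac{\max\{\mu\mid \mathbf w+\mu\mathbf y\in P\}}{\max\{\mu\mid \mathbf w-\mu\mathbf y\in P\}}$. *)

(* Defs.v *)
From HB Require Import structures.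
From mathcomp Require Import all_boot all_order all_algebra.
From mathcomp Require Import all_classical all_reals all_analysis.

Set Implicit Arguments.
Unset Strict Implicit.
Unset Printing Implicit Defensive.

Import Order.TTheory GRing.Theory Num.Theory.
Import numFieldNormedType.Exports.

Local Open Scope classical_set_scope.
Local Open Scope ring_scope.

Section LatticePolytopes.
Variables (R : realType) (d : nat).
Implicit Types (P : set 'rV[R]_d) (v w y : 'rV[R]_d).

(* The library norm on 'rV[R]_d is the sup norm, hence this definition. *)
Definition enorm y : R := Num.sqrt (\sum_(i < d) y ord0 i ^+ 2).

Definition conv_hull n (V : 'I_n -> 'rV[R]_d) : set 'rV[R]_d :=
  [set x | exists a : 'I_n -> R,
    [/\ forall i, 0 <= a i, \sum_(i < n) a i = 1
      & x = \sum_(i < n) a i *: V i]].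

Definition polytope P : Prop :=
  exists n (V : 'I_n -> 'rV[R]_d), P = conv_hull V.

(* The vertices of a polytope are its extreme points. *)
Definition vertex P v : Prop :=
  P v /\ forall x y (t : R), P x -> P y -> 0 < t < 1 ->
    v = (1 - t) *: x + t *: y -> x = v /\ y = v.

Definition in_lattice (l : nat) v : Prop :=
  forall i, exists z : int, v ord0 i = (l%:Z * z)%:~R.

Definition lattice_polytope P : Prop :=
  polytope P /\ forall v, vertex P v -> in_lattice 1 v.

Definition interior_lattice_points (l : nat) P : set 'rV[R]_d :=
  [set w | interior P w /\ in_lattice l w].

(* For w in a polytope and y != 0 the set below is nonempty and compact, so
   that its supremum is a maximum. *)
Definition reach P w y : R := sup [set mu : R | P (w + mu *: y)].

(* For w interior to a polytope, reach P w is positive and continuous on the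
   unit sphere, so that for 0 < d this supremum is finite and is a maximum.
   Taking it in \bar R leaves no default value for an unbounded ratio. *)
Definition ca w P : \bar R :=
  ereal_sup [set (reach P w y / reach P w (- y))%:E
            | y in [set y | enorm y = 1]].

End LatticePolytopes.

(* Main.v *)
Require Import Defs.
From HB Require Import structures.
From mathcomp Require Import all_boot all_order all_algebra fingroup perm.
From mathcomp Require Import all_classical all_reals all_analysis.
From mathcomp Require Import ring lra zify.

(* Write an interior point w of I_l(P) as a convex combination, with positive
   weights, of at most 2d+1 vertices of P, among them the d+1 vertices of a
   simplex S of maximal volume (Caratheodory applied to w minus a small
   multiple of the barycentre of S).  If q is a natural number and the integers
   m_i add up to q, then replacing the weights a_i by a_i + l(q a_i - m_i)
   again gives a point of lZ^d.  As long as some weight is below a threshold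
   T_2d that is doubly exponentially small in d, there is a gap between the
   large and the small weights, and a Diophantine approximation of the large
   weights gives a replacement that at least doubles the smallest weight; hence
   all weights can be made at least T_2d.  Finally, points of P have
   barycentric coordinates at most 1 with respect to S, so that every x in P
   can be given weight T_2d in w, that is, w = T_2d x + (1 - T_2d) y with y in
   P, which bounds ca(w, P) by 1/T_2d - 1. *)

Set Implicit Arguments.
Unset Strict Implicit.
Unset Printing Implicit Defensive.

Import Order.TTheory GRing.Theory Num.Theory.
Import numFieldNormedType.Exports.

Local Open Scope ring_scope.

(** * Diophantine approximation *)

(** Pigeonhole: the vectors of fractional parts of k a, for k = 0, ..., Q, fall into Q boxes with
    sides [(N i).+1%:R^-1]. Two of them share a box, and q is the difference of their
    multipliers. *)
Lemma simultaneous_approximation (R : realType) (n : nat) (a : 'I_n -> R)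
    (N : 'I_n -> nat) :
  exists q : nat, exists m : 'I_n -> int,
    (0 < q <= \prod_(i < n) (N i).+1)%N /\
    forall i, `|q%:R * a i - (m i)%:~R| <= (N i).+1%:R^-1.
Proof.
pose Q := (\prod_(i < n) (N i).+1)%N.
pose fr (k : nat) i := k%:R * a i - (Num.floor (k%:R * a i))%:~R.
have fr0 k i : 0 <= fr k i by rewrite subr_ge0 floor_le.
have fr1 k i : fr k i < 1.
  by have /andP[_] := floor_itv (k%:R * a i); rewrite intrD ltrBlDl.
pose box (k : nat) i := Num.trunc ((N i).+1%:R * fr k i).
have boxE k i : (box k i)%:R <= (N i).+1%:R * fr k i < (box k i).+1%:R.
  by apply: truncn_itv; rewrite mulr_ge0.
have box_lt k i : (box k i < (N i).+1)%N.
  rewrite -(ltr_nat R); have /andP[h _] := boxE k i.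
  by apply: le_lt_trans h _; rewrite gtr_pMr ?ltr0n.
pose F (k : 'I_Q.+1) : {dffun forall i, 'I_(N i).+1} := [ffun i => inord (box k i)].
have /injectivePn[k1 [k2 k12 eqF]] : ~~ injectiveb F.
  apply/negP => /injectiveP /leq_card.
  rewrite card_ord card_dep_ffun foldrE big_map big_enum /=.
  under eq_bigr do rewrite card_ord.
  by rewrite ltnn.
have eqbox i : box k1 i = box k2 i.
  by move/ffunP/(_ i): eqF; rewrite !ffunE => /(congr1 val) /=; rewrite !inordK.
wlog lt12 : k1 k2 k12 eqF eqbox / (k1 < k2)%N.
  move=> W; have [lt|gt|/val_inj eq] := ltngtP k1 k2.
  - exact: (W k1 k2).
  - by apply: (W k2 k1) => //; rewrite eq_sym.
  - by rewrite eq eqxx in k12.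
exists (k2 - k1)%N, (fun i => Num.floor (k2%:R * a i) - Num.floor (k1%:R * a i)).
split; first by rewrite subn_gt0 lt12 (leq_trans (leq_subr _ _)) // -ltnS.
move=> i.
have -> : (k2 - k1)%:R * a i -
   (Num.floor (k2%:R * a i) - Num.floor (k1%:R * a i))%:~R = fr k2 i - fr k1 i.
  by rewrite natrB 1?ltnW // intrB /fr; ring.
rewrite -[leRHS]mul1r ler_pdivlMr ?ltr0n // -[X in _ * X]ger0_norm ?ler0n //.
rewrite -normrM ler_norml; have := boxE k1 i; have := boxE k2 i; rewrite eqbox.
rewrite -(natr1 (box k2 i)).
move=> /andP[h1 h2] /andP[h3 h4]; apply/andP; split; lra.
Qed.

(* The solution of T_0 = 1 and T_j (2^(j+3) l)^j = T_0 ... T_(j-1): a tail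
   below T_j of the decreasing weights is negligible against the denominators
   bounded in terms of the tails T_0, ..., T_(j-1). *)
Definition threshold (R : realType) (l j : nat) : R :=
  l%:R * 2 ^+ (2 * j + 6) / (64 * l%:R) ^+ (2 ^ j)%N.

Lemma threshold0 (R : realType) l : (0 < l)%N -> threshold R l 0 = 1.
Proof.
move=> l0; have : l%:R != 0 :> R by rewrite pnatr_eq0 -lt0n.
by rewrite /threshold => ?; field.
Qed.

Lemma threshold_gt0 (R : realType) l j : (0 < l)%N -> 0 < threshold R l j.
Proof.
by move=> l0; rewrite divr_gt0 ?mulr_gt0 ?exprn_gt0 ?mulr_gt0 ?ltr0n.
Qed.

(** This is the quotient of two consecutive instances of the relation for T_j, which
    [threshold_prod] recovers from it by induction. *)
Lemma thresholdS (R : realType) l j : (0 < l)%N ->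
  threshold R l j.+1 = threshold R l j ^+ 2 / (l%:R * 2 ^+ (2 * j + 4)).
Proof.
move=> l0; have l0' : l%:R != 0 :> R by rewrite pnatr_eq0 -lt0n.
have x0 : (64 * l%:R) ^+ (2 ^ j)%N != 0 :> R.
  by rewrite expf_neq0 // mulf_neq0 // pnatr_eq0.
have y0 : 2 ^+ (2 * j) != 0 :> R by rewrite expf_neq0 // pnatr_eq0.
rewrite /threshold expnSr exprM.
have -> : (2 * j.+1 + 6 = 2 * j + 8)%N by lia.
rewrite !exprD; move: (2 ^+ (2 * j)) ((64 * l%:R) ^+ (2 ^ j)%N) x0 y0 => y x x0 y0.
by field; rewrite l0' x0 expf_neq0 ?pnatr_eq0.
Qed.

Lemma threshold_prod (R : realType) l j : (0 < l)%N ->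
  threshold R l j * (2 ^+ (j + 3) * l%:R) ^+ j = \prod_(i < j) threshold R l i.
Proof.
move=> l0; have l0' : l%:R != 0 :> R by rewrite pnatr_eq0 -lt0n.
elim: j => [|j IH]; first by rewrite threshold0 // big_ord0 expr0 mulr1.
rewrite big_ord_recr /= -IH thresholdS //.
have -> : 2 ^+ (j.+1 + 3) * l%:R = 2 ^+ (j + 3) * l%:R * 2 :> R.
  by rewrite addSn exprS; ring.
have -> : (2 * j + 4 = (j + 3) + 1 + j)%N by lia.
rewrite [_ ^+ j.+1]exprS [(_ * 2) ^+ j]exprMn !(exprD 2 _ j) (exprD 2 (j + 3)).
have y0 : 2 ^+ j != 0 :> R by rewrite expf_neq0 // pnatr_eq0.
have z0 : 2 ^+ (j + 3) != 0 :> R by rewrite expf_neq0 // pnatr_eq0.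
by field; rewrite l0' y0 z0.
Qed.

Lemma thresholdS_le (R : realType) l j : (0 < l)%N ->
  threshold R l j.+1 <= threshold R l j / 16.
Proof.
move=> l0.
(* T_i <= 1 absorbs one factor of the square and 2^(2i+4) supplies the 16; the induction below
   provides T_i <= 1. *)
have key i : threshold R l i <= 1 -> threshold R l i.+1 <= threshold R l i / 16.
  move=> t1; have t0 := threshold_gt0 R i l0.
  rewrite thresholdS // expr2 -mulrA ler_pM2l // mulrC.
  apply: le_trans (_ : (l%:R * 2 ^+ (2 * i + 4))^-1 <= _).
    by rewrite ger_pMr // invr_gt0 mulr_gt0 ?exprn_gt0 ?ltr0n.
  rewrite lef_pV2 ?posrE ?mulr_gt0 ?exprn_gt0 ?ltr0n //.
  rewrite exprD mulrA (_ : 2 ^+ 4 = 16 :> R); last by rewrite -natrX.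
  by rewrite ler_peMl // mulr_ege1 ?exprn_ege1 ?ler1n.
apply: (key); elim: j => [|j IH]; first by rewrite threshold0.
have := key j IH; lra.
Qed.

Lemma threshold_le (R : realType) l i j : (0 < l)%N -> (i <= j)%N ->
  threshold R l j <= threshold R l i.
Proof.
move=> l0; elim: j => [|j IH]; first by rewrite leqn0 => /eqP->.
rewrite leq_eqVlt => /predU1P[->//|]; rewrite ltnS => /IH; apply: le_trans.
have := thresholdS_le R j l0; have := threshold_gt0 R j l0; lra.
Qed.

Lemma threshold_ge (R : realType) l j : (0 < l)%N ->
  ((64 * l%:R) ^+ (2 ^ j)%N)^-1 <= threshold R l j.
Proof.
move=> l0; rewrite /threshold ler_peMl ?invr_ge0 ?exprn_ge0 ?mulr_ge0 //.
by rewrite mulr_ege1 ?exprn_ege1 ?ler1n.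
Qed.

(** * Doubling the smallest weight *)

Lemma geometric_half_le (R : realType) (n : nat) :
  \sum_(i < n) (2 ^+ i.+2)^-1 <= 2^-1 :> R.
Proof.
suff -> : \sum_(i < n) (2 ^+ i.+2)^-1 = 2^-1 - (2 ^+ n.+1)^-1 :> R.
  by rewrite gerBl invr_ge0 exprn_ge0.
elim: n => [|n IH]; first by rewrite big_ord0 expr1 subrr.
rewrite big_ord_recr /= IH !exprS.
have : 2 ^+ n != 0 :> R by rewrite expf_neq0 ?pnatr_eq0.
by move=> ?; field.
Qed.

(* Let j be least such that the weights from index j on sum to less than T_j.
   The m_i are approximations for 0 < i < j, with error proportional to
   a_i / 2^(i+1), and 0 for i >= j; the largest weight a_0 takes up the sum of
   all the errors. *)
Lemma doubling_step_sorted (R : realType) (n l : nat) (a : 'I_n.+1 -> R) (mu : R) :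
  (0 < l)%N -> (forall i j : 'I_n.+1, (i <= j)%N -> a j <= a i) ->
  0 < mu -> (forall i, mu <= a i) -> \sum_i a i = 1 ->
  a ord_max < threshold R l n ->
  exists (q : nat) (m : 'I_n.+1 -> int), \sum_i m i = q%:Z /\
    forall i, 2 * mu <= a i + l%:R * (q%:R * a i - (m i)%:~R).
Proof.
move=> l0 a_dec mu0 a_mu a_sum a_max.
have l1 : 1 <= l%:R :> R by rewrite ler1n.
have a_gt0 i : 0 < a i by apply: lt_le_trans (a_mu i).
have a_ge0 i : 0 <= a i by apply: ltW.
pose tail (j : nat) : R := \sum_(i < n.+1 | (j <= i)%N) a i.
have tail_n : tail n = a ord_max.
  rewrite /tail (bigD1 ord_max) //= big1 ?addr0 // => i /andP[ni /eqP]; case.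
  by apply: val_inj; apply/eqP; rewrite eqn_leq ni leq_ord.
have tail0 : tail 0%N = 1 by [].
have tail_rec (i : 'I_n.+1) : tail i = a i + tail i.+1.
  rewrite /tail (bigD1 i) //=; congr (_ + _); apply: eq_bigl => p.
  by rewrite ltn_neqAle andbC eq_sym.
have T0 j := threshold_gt0 R j l0.
have Tle i j := @threshold_le R l i j l0.
have ex_small : exists j, tail j < threshold R l j by exists n; rewrite tail_n.
case: (ex_minnP ex_small) => j tail_j j_min.
have jn : (j <= n)%N by apply: j_min; rewrite tail_n.
have tail_lt i : (i < j)%N -> threshold R l i <= tail i.
  by move=> ij; rewrite leNgt; apply/negP => /j_min; rewrite leqNgt ij.
(* The index j = 0 is excluded by tail 0 = 1 = T_0; from here on j = k + 1. *)
case: j => [|k] in tail_j j_min jn tail_lt *.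
  by rewrite tail0 threshold0 ?ltxx in tail_j.
have Tj16 := thresholdS_le R k l0.
(* The p + 1 weights with indices i, ..., i + p are at most a_i, and p + 1 <= 2^p. *)
have tail_up p (i : 'I_n.+1) : (i + p.+1 <= n)%N ->
    tail i <= 2 ^+ p * a i + tail (i + p.+1)%N.
  elim: p i => [|p IH] i ip; first by rewrite addn1 expr0 mul1r tail_rec.
  have i1 : (i.+1 < n.+1)%N by lia.
  have := IH (Ordinal i1); rewrite /= addSnnS => /(_ ip) h.
  have := a_dec i (Ordinal i1) (leqnSn i) => h2.
  rewrite tail_rec exprS; have h3 : 1 <= 2 ^+ p :> R by rewrite exprn_ege1 ?ler1n.
  have h4 : 2 ^+ p * a (Ordinal i1) <= 2 ^+ p * a i by rewrite ler_pM2l //; lra.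
  have : a i <= 2 ^+ p * a i by rewrite ler_peMl.
  lra.
(* The tail from k + 1 on is below T_(k+1) <= T_i / 16, so 2^(k-i) a_i exceeds T_i / 2. *)
have a_low (i : 'I_n.+1) : (i < k.+1)%N -> threshold R l i <= 2 ^+ (k.+1 - i) * a i.
  move=> ik; have := tail_up (k - i)%N i; rewrite -subSn // subnKC; last exact: ltnW.
  move=> /(_ jn); rewrite subSn // exprS => h1; have h2 := tail_lt i ik.
  have h3 : threshold R l k <= threshold R l i by apply: Tle.
  have := T0 i; lra.
pose C : R := 2 ^+ k.+3 * l%:R.
have C0 : 0 < C by rewrite mulr_gt0 ?exprn_gt0 ?ltr0n.
(* Chosen so that l / (N_i + 1) <= a_i / 2^(i+1). At index 0 and beyond k no approximation is used,
   and the value 0 contributes a factor 1 to the bound on q. *)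
pose N (i : 'I_n.+1) := if (0 < i < k.+1)%N then
  Num.trunc (2 ^+ i.+1 * l%:R / a i) else 0%N.
have [q [m [/andP[q0 qQ] qm]]] := simultaneous_approximation a N.
have a_le1 i : a i <= 1 by rewrite -a_sum (bigD1 i) //= lerDl sumr_ge0.
have N_ge (i : 'I_n.+1) : (0 < i < k.+1)%N -> l%:R * (N i).+1%:R^-1 <= a i / 2 ^+ i.+1.
  move=> ik; rewrite /N ik ler_pdivlMr ?exprn_gt0 // mulrAC ler_pdivrMr ?ltr0n //.
  have := truncnS_gt (2 ^+ i.+1 * l%:R / a i).
  by rewrite ltr_pdivrMr // mulrC [_ * a i]mulrC => /ltW.
have N_le (i : 'I_n.+1) : (0 < i < k.+1)%N -> (N i).+1%:R <= C / threshold R l i.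
  move=> ik; rewrite ler_pdivlMr //; have /andP[_ ik2] := ik.
  apply: le_trans (_ : (N i).+1%:R * (2 ^+ (k.+1 - i) * a i) <= _).
    by rewrite ler_wpM2l // a_low.
  have h1 : 1 <= 2 ^+ i.+1 * l%:R / a i.
    by rewrite ler_pdivlMr // mul1r (le_trans (a_le1 i)) // mulr_ege1 ?exprn_ege1 ?ler1n.
  (* For x >= 1 the truncation plus 1 is at most 2 x. This 2, together with 2^(i+1) and 2^(k+1-i),
     makes up the 2^(k+3) in C. *)
  have h2 : (N i).+1%:R <= 2 * (2 ^+ i.+1 * l%:R / a i).
    rewrite /N ik -natr1; move: h1; move: (_ / a i) => x h1.
    have : 0 <= x by lra.
    rewrite -truncn_le; lra.
  apply: le_trans (_ : 2 * (2 ^+ i.+1 * l%:R / a i) * (2 ^+ (k.+1 - i) * a i) <= _).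
    by rewrite ler_wpM2r // mulr_ge0 ?exprn_ge0.
  have -> : C = 2 * 2 ^+ i.+1 * 2 ^+ (k.+1 - i) * l%:R.
    by rewrite /C -exprS -exprD; congr (_ ^+ _ * _); lia.
  have ai0 : a i != 0 by rewrite gt_eqF.
  suff -> : 2 * (2 ^+ i.+1 * l%:R / a i) * (2 ^+ (k.+1 - i) * a i) =
    2 * 2 ^+ i.+1 * 2 ^+ (k.+1 - i) * l%:R by [].
  by field.
have Qle : q%:R * \prod_(i < k.+1) threshold R l i <= C ^+ k.
  have Pgt0 : 0 < \prod_(i < k.+1) threshold R l i by apply: prodr_gt0.
  rewrite -ler_pdivlMr //.
  apply: le_trans (_ : (\prod_(i < n.+1) (N i).+1)%:R <= _); first by rewrite ler_nat.
  pose g i : R := if i is 0 then 1 else C / threshold R l i.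
  apply: le_trans (_ : \prod_(i < n.+1) (if (i < k.+1)%N then g i else 1) <= _).
    rewrite natr_prod ler_prod // => i _; rewrite ler0n /=.
    case: ifP => [ik|ik]; last by rewrite /N ik andbF.
    case: (posnP i) => [i0|i0]; first by rewrite /N i0.
    rewrite (_ : g i = C / threshold R l i); first by rewrite N_le ?i0.
    by rewrite /g; case: (nat_of_ord i) i0.
  rewrite -big_mkcond -(big_ord_widen _ g) 1?ltnW //.
  rewrite !big_ord_recl threshold0 //= !mul1r big_split /= prodr_const card_ord.
  by rewrite prodfV.
(* In [threshold_prod] at k + 1 the base 2^(k+4) l equals 2 C; after cancelling C^k a factor C = 4 *
   2^(k+1) l remains to absorb l. *)
have qT : l%:R * q%:R * threshold R l k.+1 <= (2 ^+ k.+1)^-1 / 4.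
  rewrite -threshold_prod // in Qle.
  have e : 2 ^+ (k.+1 + 3) * l%:R = 2 * C by rewrite /C addn3 exprS mulrA.
  rewrite e exprMn [C ^+ k.+1]exprS in Qle.
  have {}Qle : q%:R * threshold R l k.+1 * 2 ^+ k.+1 * C <= 1.
    rewrite -(ler_pM2r (exprn_gt0 k C0)) mul1r; apply: le_trans Qle.
    by rewrite le_eqVlt; apply/orP; left; apply/eqP; ring.
  have y0 : 0 < 2 ^+ k.+1 :> R by rewrite exprn_gt0.
  have y1 : 1 <= 2 ^+ k.+1 :> R by rewrite exprn_ege1 // ler1n.
  rewrite mulrC ler_pdivlMr ?ltr0n //.
  rewrite -[leRHS]mul1r ler_pdivlMr //.
  apply: le_trans Qle.
  have -> : C = 4 * 2 ^+ k.+1 * l%:R by rewrite /C !exprS; ring.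
  set x := _ * 4 * _; have x0 : 0 <= x.
    have := ltW (T0 k.+1); rewrite /x; move: (threshold _ _ _) => t t0.
    by rewrite !mulr_ge0 // ltW.
  have -> : q%:R * threshold R l k.+1 * 2 ^+ k.+1 * (4 * 2 ^+ k.+1 * l%:R) =
     x * 2 ^+ k.+1 by rewrite /x; ring.
  by rewrite ler_peMr.
pose m2 (i : 'I_n.+1) := if (i < k.+1)%N then m i else 0.
pose m' i := if i == ord0 then q%:Z - \sum_(p | p != ord0) m2 p else m2 i.
have m'E i : i != ord0 -> m' i = m2 i by rewrite /m' => /negPf ->.
exists q, m'; split.
  by rewrite (bigD1 ord0) //= (eq_bigr m2) // /m' eqxx subrK.
have aj : a ord0 * 2 ^+ k.+1 >= 1.
  by have := a_low ord0 (ltn0Sn k); rewrite threshold0 // subn0 mulrC.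
(* The upper bound is what index 0 has to pay for; the lower bound says that at most a quarter of
   a_i is lost. *)
have small i : i != ord0 -> l%:R * (q%:R * a i - (m2 i)%:~R) <=
    a ord0 / 2 ^+ i.+1 + (if (k.+1 <= i)%N then l%:R * q%:R * a i else 0) /\
    (a i - a i / 4 <= a i + l%:R * (q%:R * a i - (m2 i)%:~R)).
  move=> i0; have i0' : (0 < i)%N by rewrite lt0n.
  have a0i : a i <= a ord0 by apply: a_dec.
  have y1 : 4 <= 2 ^+ i.+1 :> R.
    case: (nat_of_ord i) i0' => // p _; rewrite !exprS mulrA -natrM.
    by rewrite ler_peMr // exprn_ege1 // ler1n.
  have y0 : 0 < 2 ^+ i.+1 :> R by lra.
  have z0 : a i / 2 ^+ i.+1 <= a ord0 / 2 ^+ i.+1 by rewrite ler_pM2r ?invr_gt0.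
  have z1 : a i / 2 ^+ i.+1 <= a i / 4 by rewrite ler_pM2l // lef_pV2 ?posrE.
  rewrite /m2; case: ifPn => [ik|]; last first.
    rewrite -leqNgt => ->; rewrite subr0 mulrA.
    have : 0 <= l%:R * q%:R * a i by rewrite !mulr_ge0.
    have : 0 <= a ord0 / 2 ^+ i.+1 by rewrite divr_ge0 // ltW.
    have := a_gt0 i; split; lra.
  rewrite leqNgt ik addr0 /=.
  have h1 := N_ge i (introT andP (conj i0' ik)).
  have := qm i; rewrite -(ler_pM2l (lt_le_trans ltr01 l1)) => /le_trans /(_ h1) h2.
  have : `|l%:R * (q%:R * a i - (m i)%:~R)| <= a i / 2 ^+ i.+1.
    by rewrite normrM ger0_norm ?ler0n.
  rewrite ler_norml => /andP[h3 h4]; split; lra.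
(* The a_i sum to 1 and the m'_i to q, so all changes sum to 0. The other indices cost at most a_0 /
   2 through the geometric series and a_0 / 4 through the small tail. *)
have head : a ord0 / 4 <= a ord0 + l%:R * (q%:R * a ord0 - (m' ord0)%:~R).
  have -> : q%:R * a ord0 - (m' ord0)%:~R =
      - \sum_(p | p != ord0) (q%:R * a p - (m2 p)%:~R).
    rewrite /m' eqxx sumrB -mulr_sumr rmorphB /= rmorph_sum /=.
    have -> : a ord0 = 1 - \sum_(p | p != ord0) a p.
      by rewrite -a_sum (bigD1 ord0) //= addrK.
    by rewrite -pmulrn; ring.
  rewrite mulrN mulr_sumr.
  have : \sum_(p < n.+1 | p != ord0) l%:R * (q%:R * a p - (m2 p)%:~R) <=
     \sum_(p < n.+1 | p != ord0) (a ord0 / 2 ^+ p.+1 +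
        (if (k.+1 <= p)%N then l%:R * q%:R * a p else 0)).
    by apply: ler_sum => p /small[].
  rewrite big_split /= -[\sum_(p < _ | _) (a ord0 / _)]mulr_sumr.
  have -> : \sum_(p < n.+1 | p != ord0) (2 ^+ p.+1)^-1 = \sum_(p < n) (2 ^+ p.+2)^-1 :> R.
    rewrite big_mkcond big_ord_recl /= add0r; exact: eq_bigr.
  have -> : \sum_(p < n.+1 | p != ord0) (if (k.+1 <= p)%N then l%:R * q%:R * a p else 0)
      = l%:R * q%:R * tail k.+1.
    rewrite -big_mkcondr /tail mulr_sumr; apply: eq_bigl => p.
    by case: p => -[].
  have h1 : a ord0 * \sum_(p < n) (2 ^+ p.+2)^-1 <= a ord0 / 2.
    by rewrite ler_wpM2l // geometric_half_le.
  have h2 : l%:R * q%:R * tail k.+1 <= l%:R * q%:R * threshold R l k.+1.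
    by rewrite ler_wpM2l ?mulr_ge0 // ltW.
  have h3 : (2 ^+ k.+1)^-1 / 4 <= a ord0 / 4.
    by rewrite ler_pM2r ?invr_gt0 // -div1r ler_pdivrMr ?exprn_gt0.
  lra.
have kn : (k < n.+1)%N by lia.
(* The gap: mu <= tail (k+1) < T_(k+1) <= T_k / 16 <= a_k / 8. *)
have big (i : 'I_n.+1) : (i < k.+1)%N -> 2 * mu <= a i / 4.
  move=> ik; have h1 := a_low (Ordinal kn) (leqnn _); rewrite /= subSnn expr1 in h1.
  have h2 : a (Ordinal kn) <= a i by apply: a_dec.
  have h3 : mu <= tail k.+1.
    rewrite /tail (bigD1 ord_max) //=.
    by have := a_mu ord_max; have : 0 <= \sum_(i < n.+1 | (k < i)%N && (i != ord_max)) a i;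
      [exact: sumr_ge0 | lra].
  have := T0 k; lra.
move=> i; case: (eqVneq i ord0) => [->|i0].
  by apply: le_trans head; apply: big.
rewrite m'E //; have [_ h] := small i i0.
case: (ltnP i k.+1) => ik; first by have := big i ik; have := a_gt0 i; lra.
rewrite /m2 ltnNge ik /= subr0 mulrA.
(* In the tail m_i = 0 and l q >= 1, so the weight itself at least doubles. *)
have : 1 * a i <= l%:R * q%:R * a i by rewrite ler_pM2r // mulr_ege1 // ler1n.
by have := a_mu i; lra.
Qed.

Lemma sorting_perm (R : realType) (n : nat) (a : 'I_n.+1 -> R) :
  exists s : {perm 'I_n.+1}, forall i j : 'I_n.+1, (i <= j)%N -> a (s j) <= a (s i).
Proof.
pose r (i j : 'I_n.+1) := a j <= a i.
pose e := sort r (enum 'I_n.+1).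
have e_size : size e = n.+1 by rewrite size_sort size_enum_ord.
have e_uniq : uniq e by rewrite sort_uniq enum_uniq.
have e_sorted : sorted r e by apply: sort_sorted => i j; rewrite /r le_total.
have f_inj : injective (fun i : 'I_n.+1 => nth ord0 e i).
  by move=> i j /eqP; rewrite nth_uniq ?e_size // => /eqP /val_inj.
exists (perm f_inj) => i j ij; rewrite !permE.
apply: (sorted_leq_nth _ _ ord0 e_sorted) => //.
- by move=> y x z rxy ryz; exact: le_trans rxy.
- by move=> x; rewrite /r lexx.
- by rewrite inE e_size.
- by rewrite inE e_size.
Qed.

Lemma doubling_step (R : realType) (n l : nat) (a : 'I_n.+1 -> R) (mu : R) :
  (0 < l)%N -> 0 < mu -> (forall i, mu <= a i) -> \sum_i a i = 1 ->
  (exists i, a i < threshold R l n) ->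
  exists (q : nat) (m : 'I_n.+1 -> int), \sum_i m i = q%:Z /\
    forall i, 2 * mu <= a i + l%:R * (q%:R * a i - (m i)%:~R).
Proof.
move=> l0 mu0 a_mu a_sum [i0 a_i0]; have [s s_dec] := sorting_perm a.
have [|||q [m [m_sum m_ge]]] := @doubling_step_sorted R n l (a \o s) mu l0 s_dec mu0.
- by move=> i /=.
- by rewrite -a_sum [RHS](reindex_inj (@perm_inj _ s)).
- apply: le_lt_trans a_i0; rewrite -[i0](permKV s) /=.
  by apply: s_dec; rewrite leq_ord.
exists q, (m \o (s^-1)%g); split.
  by rewrite (reindex_inj (@perm_inj _ s)) -m_sum; apply: eq_bigr => i _ /=; rewrite permK.
by move=> i; have := m_ge ((s^-1)%g i); rewrite /= permKV.
Qed.

(** Doubling steps are iterated until all weights reach the threshold. The predicate [L] abstracts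
    what they preserve, namely that the combination of the vertices lies in lZ^d. *)
Lemma balanced_weights (R : realType) (n l : nat) (L : ('I_n.+1 -> R) -> Prop)
    (a0 : 'I_n.+1 -> R) :
  (0 < l)%N ->
  (forall a (q : nat) (m : 'I_n.+1 -> int), L a -> \sum_i m i = q%:Z ->
    L (fun i => a i + l%:R * (q%:R * a i - (m i)%:~R))) ->
  L a0 -> (forall i, 0 < a0 i) -> \sum_i a0 i = 1 ->
  exists a, [/\ L a, \sum_i a i = 1 & forall i, threshold R l n <= a i].
Proof.
move=> l0 L_step L_a0 a0_gt0 a0_sum.
have [mu mu0 a0_mu] : exists2 mu, 0 < mu & forall i, mu <= a0 i.
  case: (Order.TotalTheory.arg_minP a0 (erefl : xpredT (@ord0 n))) => i _ h.
  by exists (a0 i) => // j; apply: h.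
(* N bounds the number of doublings: at N = 0 every weight would exceed 1, although they sum to
   1. *)
have [N N_gt] : exists N, 1 < mu * 2 ^+ N.
  exists (Num.trunc mu^-1).+1; rewrite -ltr_pdivrMl // mulr1.
  apply: lt_le_trans (truncnS_gt _) _.
  by rewrite -natrX ler_nat ltnW // ltn_expl.
elim: N mu a0 mu0 N_gt L_a0 a0_mu a0_sum {a0_gt0} => [|N IH] mu a mu0 N_gt L_a a_mu a_sum.
  have : a ord0 <= 1.
    rewrite -a_sum (bigD1 ord0) //= lerDl sumr_ge0 // => i _.
    by apply: ltW (lt_le_trans mu0 _).
  have := a_mu ord0; rewrite expr0 in N_gt; lra.
have [/forallP a_ge|] := boolP [forall i, threshold R l n <= a i]; first by exists a.
rewrite negb_forall => /existsP[i]; rewrite -ltNge => a_i.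
have [|q [m [m_sum m_ge]]] := @doubling_step R n l a mu l0 mu0 a_mu a_sum; first by exists i.
apply: (IH (2 * mu)) m_ge _ => //.
- by rewrite mulr_gt0.
- by rewrite exprS mulrA [mu * 2]mulrC in N_gt.
- exact: L_step.
- rewrite big_split /= a_sum -mulr_sumr sumrB -mulr_sumr a_sum -rmorph_sum /= m_sum.
  by rewrite mulr1 subrr mulr0 addr0.
Qed.

(** * Convex combinations *)

Lemma linear_relation (F : fieldType) (I : finType) (m : nat)
    (U : I -> 'rV[F]_m) (J : {set I}) : (m < #|J|)%N ->
  exists mu : I -> F, [/\ forall i, i \notin J -> mu i = 0,
    exists i, mu i != 0 & \sum_i mu i *: U i = 0].
Proof.
move=> mJ; pose M := \matrix_(k < #|J|) U (enum_val k).
have : kermx M != 0.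
  rewrite -mxrank_eq0 mxrank_ker -lt0n subn_gt0.
  exact: leq_ltn_trans (rank_leq_col M) mJ.
case/rowV0Pn => v /sub_kermxP vM v0.
have [k vk] : exists k, v 0 k != 0.
  apply/existsP; rewrite -negb_forall; apply: contraNN v0 => /forallP v0.
  by apply/eqP/rowP => k; rewrite mxE; apply/eqP.
(* The kernel vector extended by 0 outside J; each sum has at most one term. *)
exists (fun i => \sum_(k < #|J| | enum_val k == i) v 0 k); split.
- move=> i iJ; rewrite big_pred0 // => k'; apply: contraNF iJ => /eqP <-.
  exact: enum_valP.
- exists (enum_val k); rewrite (big_pred1 k) // => k'.
  by rewrite (inj_eq enum_val_inj).
- transitivity (v *m M); last by rewrite vM.
  rewrite mulmx_sum_row [RHS](partition_big (@enum_val _ (mem J)) xpredT) //=.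
  apply: eq_bigr => i _; rewrite scaler_suml; apply: eq_bigr => k' /eqP <-.
  by rewrite rowK.
Qed.

(* Moving along a linear relation in the direction that does not decrease the
   weight of [i0] keeps that weight positive. *)
Lemma caratheodory_marked (R : realFieldType) (I : finType) (m : nat)
    (U : I -> 'rV[R]_m) (c : 'cV[R]_m) (a : I -> R) (i0 : I) :
  (forall i, U i *m c = 1%:M) -> (forall i, 0 <= a i) -> 0 < a i0 ->
  exists b : I -> R, [/\ forall i, 0 <= b i, 0 < b i0,
    \sum_i b i *: U i = \sum_i a i *: U i & (#|[set i | b i != 0%R]| <= m)%N].
Proof.
move=> Uc; have [n] := ubnP #|[set i | a i != 0%R]|.
elim: n a => // n IH a; rewrite ltnS => an a_ge0 a_i0.
have [am|am] := leqP #|[set i | a i != 0%R]| m; first by exists a.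
have [mu [mu_supp mu_i0 mu_neq0 mu_rel]] : exists mu : I -> R,
    [/\ forall i, i \notin [set i | a i != 0%R] -> mu i = 0, 0 <= mu i0,
       exists i, mu i != 0 & \sum_i mu i *: U i = 0].
  have [mu [h1 [i hi] h2]] := linear_relation U am.
  have [mu0|mu0] := leP 0 (mu i0); first by exists mu; split=> //; exists i.
  exists (fun i => - mu i); split.
  - by move=> j /h1 ->; rewrite oppr0.
  - by rewrite oppr_ge0 ltW.
  - by exists i; rewrite oppr_eq0.
  - by under eq_bigr do rewrite scaleNr; rewrite sumrN h2 oppr0.
(* All [U i] lie on the affine hyperplane where c takes the value 1, so the coefficients of a linear
   relation sum to 0 and one of them is negative. *)
have mu_sum : \sum_i mu i = 0.
  have := congr1 (fun M => (M *m c) 0 0) mu_rel.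
  rewrite /= mul0mx [RHS]mxE mulmx_suml summxE => sum0; rewrite -[RHS]sum0; apply: eq_bigr => i _.
  by rewrite -scalemxAl Uc !mxE eqxx mulr1.
have [i1 mu_i1] : exists i, mu i < 0.
  apply/existsP; case: mu_neq0 => i; apply: contraNT; rewrite negb_exists => /forallP h.
  apply/eqP/(psumr_eq0P (P := xpredT) (F := mu)) => // j _.
  by have := h j; rewrite -leNgt.
case: (Order.TotalTheory.arg_minP (P := fun i => mu i < 0) (fun i => a i / - mu i) mu_i1).
move=> {mu_i1} i1 mu_i1 i1_min.
(* The largest step that keeps all weights nonnegative. It annihilates the weight of i1, which
   differs from i0 because mu is nonnegative at i0. *)
pose t := a i1 / - mu i1.
have t0 : 0 <= t by rewrite divr_ge0 // oppr_ge0 ltW.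
have b_i1 : a i1 + t * mu i1 = 0.
  by rewrite /t invrN mulrN mulNr divfK ?subrr // lt_eqF.
have a_i1 : a i1 != 0.
  apply: contraTneq mu_i1 => ai1; rewrite mu_supp ?ltxx // inE ai1 eqxx //.
have [|||b [b_ge0 b_i0 b_sum b_card]] := IH (fun i => a i + t * mu i).
- apply: leq_trans an; apply: proper_card; apply/properP; split.
    apply/fintype.subsetP => i; rewrite !inE; apply: contraNneq => ai.
    by rewrite ai mu_supp ?mulr0 ?addr0 // inE ai eqxx.
  by exists i1; rewrite !inE // b_i1 eqxx.
- move=> i; have [mu0|mu0] := leP 0 (mu i); first by rewrite addr_ge0 // mulr_ge0.
  have := i1_min i mu0; rewrite -/t ler_pdivlMr ?oppr_gt0 // mulrN.
  by rewrite -subr_ge0 opprK.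
- by rewrite ltr_wpDr // mulr_ge0.
exists b; split=> //; rewrite b_sum.
under eq_bigr do rewrite scalerDl -scalerA.
by rewrite big_split /= -scaler_sumr mu_rel scaler0 addr0.
Qed.

(** * Row selections of maximal determinant *)

Lemma cramer_row (F : fieldType) (n : nat) (M : 'M[F]_n) (u : 'rV[F]_n) (k : 'I_n) :
  (u *m \adj M) 0 k = \det (\matrix_i if i == k then u else row i M).
Proof.
(* The cofactors along row k do not involve that row, so they agree with those of M. *)
rewrite (expand_det_row _ k) mxE; apply: eq_bigr => j _.
rewrite !mxE eqxx; congr (_ * (_ * \det _)).
apply/matrixP => i j'; rewrite !mxE eq_sym (negPf (neq_lift k i)) !mxE //.
Qed.

(** Take f maximizing the absolute determinant over all maps; it is injective because a repeated row
    gives determinant 0. By Cramer's rule the entries of B are quotients of determinants of row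
    selections, with the maximal one in the denominator. *)
Lemma max_det_rows (R : realFieldType) (N n : nat) (A : 'M[R]_(N, n)) : row_full A ->
  exists f : 'I_n -> 'I_N, injective f /\
    exists B : 'M[R]_(N, n),
      B *m rowsub f A = A /\ forall j k, `|B j k| <= 1.
Proof.
move=> A_full.
pose g : {ffun 'I_n -> 'I_N} := finfun (fullrankfun A_full).
have g_det : \det (rowsub g A) != 0.
  rewrite -unitfE -unitmxE -row_full_unit.
  suff -> : rowsub g A = rowsub (fullrankfun A_full) A by apply: fullrowsub_full.
  by apply/matrixP => i j; rewrite !mxE ffunE.
case: (@Order.TotalTheory.arg_maxP _ _ _ g xpredT
  (fun f => `|\det (rowsub f A)|) erefl) => f _ f_max.
have f_det : \det (rowsub f A) != 0.
  by rewrite -normr_gt0; apply: lt_le_trans (f_max g _); rewrite ?normr_gt0.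
exists f; split.
  move=> k1 k2 f12; apply/eqP/negPn/negP => k12; case/eqP: f_det.
  apply: (determinant_alternate k12) => j; by rewrite !mxE f12.
have f_unit : rowsub f A \in unitmx by rewrite unitmxE unitfE.
exists (A *m invmx (rowsub f A)); split; first by rewrite mulmxKV.
move=> j k; rewrite /invmx f_unit -scalemxAr mxE.
have -> : (A *m \adj (rowsub f A)) j k = (row j A *m \adj (rowsub f A)) 0 k.
  by rewrite -row_mul [RHS]mxE.
rewrite cramer_row normrM normfV mulrC ler_pdivrMr ?normr_gt0 // mul1r.
pose f' := [ffun i => if i == k then j else f i].
suff -> : (\matrix_i (if i == k then row j A else row i (rowsub f A))) = rowsub f' A.
  exact: f_max.
by apply/matrixP => i i'; rewrite !mxE ffunE; case: ifP => _; rewrite !mxE.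
Qed.

(** * Homogeneous coordinates and convex hulls *)

Local Open Scope classical_set_scope.

(** The extra coordinate 1 makes affine combinations linear: it records the sum of the weights. *)
Definition homogenize (R : realType) (d : nat) (v : 'rV[R]_d) : 'rV[R]_(d + 1) :=
  row_mx v 1%:M.

Lemma homogenize_sum (R : realType) (d n : nat) (a : 'I_n -> R) (V : 'I_n -> 'rV[R]_d) :
  \sum_i a i *: homogenize (V i) = row_mx (\sum_i a i *: V i) (\sum_i a i)%:M.
Proof.
apply/rowP => j; rewrite summxE mxE.
case: splitP => j' jj'; rewrite ?summxE.
  apply: eq_bigr => i _; rewrite !mxE (_ : j = lshift 1 j') ?(unsplitK (inl j')) //.
  exact: val_inj.
rewrite mxE ord1 eqxx mulr1n; apply: eq_bigr => i _.
rewrite !mxE (_ : j = rshift d j') ?(unsplitK (inr j')); last exact: val_inj.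
by rewrite mxE ord1 eqxx mulr1.
Qed.

Lemma homogenize_combination (R : realType) (d n : nat) (a : 'I_n -> R)
    (V : 'I_n -> 'rV[R]_d) (x : 'rV[R]_d) :
  homogenize x = \sum_i a i *: homogenize (V i) <->
  \sum_i a i = 1 /\ x = \sum_i a i *: V i.
Proof.
rewrite homogenize_sum; split; last by case=> -> ->.
by case/eq_row_mx => -> /matrixP/(_ 0 0); rewrite !mxE eqxx !mulr1n => ->.
Qed.

Lemma conv_hull_mem (R : realType) (d n : nat) (V : 'I_n -> 'rV[R]_d) i :
  conv_hull V (V i).
Proof.
exists (fun j => (j == i)%:R); split=> [j||].
- by rewrite ler0n.
- by rewrite (bigD1 i) //= eqxx big1 ?addr0 // => j /negPf ->.
- rewrite (bigD1 i) //= eqxx scale1r big1 ?addr0 // => j /negPf ->.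
  by rewrite scale0r.
Qed.

Lemma conv_hull_convex (R : realType) (d n : nat) (V : 'I_n -> 'rV[R]_d) x y (t : R) :
  conv_hull V x -> conv_hull V y -> 0 <= t <= 1 ->
  conv_hull V ((1 - t) *: x + t *: y).
Proof.
move=> [a [a0 a1 ->]] [b [b0 b1 ->]] /andP[t0 t1].
exists (fun i => (1 - t) * a i + t * b i); split=> [i||].
- by rewrite addr_ge0 // mulr_ge0 // subr_ge0.
- by rewrite big_split /= -!mulr_sumr a1 b1 !mulr1 subrK.
- rewrite !scaler_sumr -big_split /=; apply: eq_bigr => i _.
  by rewrite !scalerA -scalerDl.
Qed.

Lemma conv_hull_sub (R : realType) (d m n : nat) (W : 'I_m -> 'rV[R]_d)
    (V : 'I_n -> 'rV[R]_d) :
  (forall j, conv_hull V (W j)) -> conv_hull W `<=` conv_hull V.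
Proof.
move=> /choice[b WV] x [a [a0 a1 ->]].
exists (fun i => \sum_j a j * b j i); split=> [i||].
- by apply: sumr_ge0 => j _; rewrite mulr_ge0 //; case: (WV j).
- rewrite exchange_big /= -[RHS]a1; apply: eq_bigr => j _.
  by rewrite -mulr_sumr; case: (WV j) => _ -> _; rewrite mulr1.
- under [RHS]eq_bigr do rewrite scaler_suml.
  rewrite exchange_big /=; apply: eq_bigr => j _.
  case: (WV j) => _ _ ->; rewrite scaler_sumr.
  by apply: eq_bigr => i _; rewrite scalerA.
Qed.

(** Solve the relation for [V i] and divide by [1 - c i]. *)
Lemma conv_hull_lift (R : realType) (d n : nat) (V : 'I_n.+1 -> 'rV[R]_d) i
    (c : 'I_n.+1 -> R) :
  (forall j, 0 <= c j) -> \sum_j c j = 1 -> V i = \sum_j c j *: V j -> c i < 1 ->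
  conv_hull (V \o lift i) (V i).
Proof.
move=> c0 c1 Vi ci; exists (fun j => c (lift i j) / (1 - c i)).
have ci0 : 1 - c i != 0 by rewrite subr_eq0 gt_eqF.
have cs : \sum_j c (lift i j) = 1 - c i.
  by rewrite -c1 (bigD1_ord i) //= addrAC subrr add0r.
split=> [j||].
- by rewrite divr_ge0 // subr_ge0 ltW.
- by rewrite -mulr_suml cs divff.
- rewrite (bigD1_ord i) //= in Vi.
  have {Vi} : (1 - c i) *: V i = \sum_j c (lift i j) *: V (lift i j).
    by rewrite scalerBl scale1r {1}Vi addrAC subrr add0r.
  move=> /(congr1 (fun v => (1 - c i)^-1 *: v)) /=.
  rewrite scalerA mulVf // scale1r => ->; rewrite scaler_sumr.
  by apply: eq_bigr => j _; rewrite scalerA mulrC.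
Qed.

Lemma polytope_vertices (R : realType) (d : nat) (P : set 'rV[R]_d) : polytope P ->
  exists n (V : 'I_n -> 'rV[R]_d), P = conv_hull V /\ forall i, vertex P (V i).
Proof.
move=> [n [V ->]]; elim: n V => [|n IH] V; first by exists 0%N, V; split=> // -[].
have [h|/existsNP[i iV]] := pselect (forall i, vertex (conv_hull V) (V i)).
  by exists n.+1, V.
suff -> : conv_hull V = conv_hull (V \o lift i) by apply: IH.
have Vi : conv_hull (V \o lift i) (V i).
  apply: contra_notP iV => Vi; split; first exact: conv_hull_mem.
  move=> x y t [a [a0 a1 xE]] [b [b0 b1 yE]] /andP[t0 t1] ViE.
  have le1 (g : 'I_n.+1 -> R) : (forall j, 0 <= g j) -> \sum_j g j = 1 -> g i <= 1.
    by move=> g0 g1; rewrite -g1 (bigD1 i) //= lerDl sumr_ge0.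
  have eq1 (g : 'I_n.+1 -> R) : (forall j, 0 <= g j) -> \sum_j g j = 1 -> g i = 1 ->
      \sum_j g j *: V j = V i.
    move=> g0 g1 gi; rewrite (bigD1 i) //= gi scale1r big1 ?addr0 // => j ji.
    have : \sum_(j | j != i) g j = 0 by move: g1; rewrite (bigD1 i) //= gi; lra.
    by move/psumr_eq0P => -> //; rewrite scale0r.
  (* These are weights for [V i] itself. If [c i < 1], then [V i] is in the hull of the others;
     otherwise [a i] and [b i] are both 1, so that x = y = [V i]. *)
  pose c j := (1 - t) * a j + t * b j.
  have : ~ c i < 1.
    move=> ci; apply: Vi; apply: (@conv_hull_lift _ _ _ _ _ c) => //.
    - by move=> j; rewrite addr_ge0 // mulr_ge0 //; lra.
    - by rewrite big_split /= -!mulr_sumr a1 b1; lra.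
    - rewrite {1}ViE xE yE !scaler_sumr -big_split /=; apply: eq_bigr => j _.
      by rewrite !scalerA -scalerDl.
  move=> /negP; rewrite -leNgt /c => ci.
  have ai := le1 a a0 a1; have bi := le1 b b0 b1.
  have ai1 : a i = 1 by apply/eqP; rewrite eq_le ai /=; nra.
  have bi1 : b i = 1 by apply/eqP; rewrite eq_le bi /=; nra.
  by rewrite xE yE !eq1.
apply/seteqP; split; apply: conv_hull_sub => j.
  by case: (unliftP i j) => [k ->|-> //]; apply: (conv_hull_mem (V \o lift i)).
exact: conv_hull_mem.
Qed.

Lemma conv_hull_bounded (R : realType) (d n : nat) (V : 'I_n -> 'rV[R]_d) :
  exists C : R, forall x i, conv_hull V x -> `|x ord0 i| <= C.
Proof.
exists (\sum_(j < n) \sum_(i < d) `|V j ord0 i|) => x i [a [a0 a1 ->]].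
rewrite summxE; apply: le_trans (ler_norm_sum _ _ _) _; apply: ler_sum => j _.
rewrite mxE normrM ger0_norm //.
have aj : a j <= 1 by rewrite -a1 (bigD1 j) //= lerDl sumr_ge0.
apply: le_trans (_ : `|V j ord0 i| <= _); first by rewrite ler_piMl.
by rewrite (bigD1 i) //= lerDl sumr_ge0.
Qed.

(** * Interior points and the coefficient of asymmetry *)

Lemma interior_segment (R : realType) (d : nat) (P : set 'rV[R]_d) w v : interior P w ->
  exists2 e : R, 0 < e & forall t, `|t| <= e -> P (w + t *: v).
Proof.
move=> /nbhs_ballP[r /= r0 rP].
have v0 : 0 < `|v| + 1 by rewrite ltr_wpDl.
exists (r / 2 / (`|v| + 1)) => [|t te]; first by rewrite !divr_gt0.
apply: rP; rewrite -ball_normE /ball_ /= opprD addrA subrr add0r normrN normrZ.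
have : `|t| * `|v| <= r / 2.
  apply: le_trans (_ : r / 2 / (`|v| + 1) * (`|v| + 1) <= _).
    by rewrite ler_pM // lerDl.
  by rewrite divfK // gt_eqF.
lra.
Qed.

Lemma interior_homothety (R : realType) (d : nat) (P : set 'rV[R]_d) x y (e : R) :
  (forall u v (t : R), P u -> P v -> 0 <= t <= 1 -> P ((1 - t) *: u + t *: v)) ->
  interior P x -> P y -> 0 < e <= 1 -> interior P (e *: x + (1 - e) *: y).
Proof.
move=> P_conv /nbhs_ballP[r /= r0 rP] Py /andP[e0 e1].
apply/nbhs_ballP; exists (e * r); first exact: mulr_gt0.
move=> z; rewrite -ball_normE /ball_ /= => hz.
(* The point z is the image of x + h under the homothety with centre y and ratio e, and h has norm
   below r. *)
pose h := e^-1 *: (z - (e *: x + (1 - e) *: y)).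
have -> : z = (1 - (1 - e)) *: (x + h) + (1 - e) *: y.
  by apply/rowP => i; rewrite !mxE; field; rewrite gt_eqF.
apply: P_conv => //; last by lra.
apply: rP; rewrite -ball_normE /ball_ /= opprD addrA subrr add0r normrN normrZ.
by rewrite normfV gtr0_norm // ltr_pdivrMl // -normrN opprB.
Qed.

(** If w + mu v is in P, then the complementary point y is w - (e / (1 - e)) mu v, so the reach
    along v is at most 1/e - 1 times the reach along -v. *)
Lemma ca_le (R : realType) (d : nat) (P : set 'rV[R]_d) (w : 'rV[R]_d) (e : R) :
  (exists C : R, forall x i, P x -> `|x ord0 i| <= C) -> 0 < e < 1 -> P w ->
  (forall x, P x -> exists2 y, P y & w = e *: x + (1 - e) *: y) ->
  (ca w P <= (e^-1 - 1)%:E)%E.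
Proof.
move=> [C P_bnd] /andP[e0 e1] Pw P_w.
apply: ge_ereal_sup => _ [v v1 <-]; rewrite lee_fin.
(* Boundedness makes [sup] in [reach] a genuine supremum; a nonzero coordinate of u gives the
   bound. *)
have ray_bnd u : enorm u = 1 -> has_ubound [set mu : R | P (w + mu *: u)].
  move=> u1; have [i ui] : exists i, u ord0 i != 0.
    apply/existsP; rewrite -negb_forall; apply/negP => /forallP u0.
    move: u1; rewrite /enorm big1 ?sqrtr0; last first.
      by move=> i _; rewrite (eqP (u0 i)) expr0n.
    by move/eqP; rewrite eq_sym oner_eq0.
  exists ((C + `|w ord0 i|) / `|u ord0 i|) => mu /(P_bnd _ i).
  rewrite !mxE => h; rewrite ler_pdivlMr ?normr_gt0 //.
  apply: le_trans (_ : `|mu * u ord0 i| <= _); first by rewrite normrM ler_wpM2r // ler_norm.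
  have -> : mu * u ord0 i = (w ord0 i + mu * u ord0 i) - w ord0 i by ring.
  by apply: le_trans (ler_normB _ _) _; rewrite lerD2r.
have nv1 : enorm (- v) = 1.
  by rewrite -[RHS]v1 /enorm; congr Num.sqrt; apply: eq_bigr => i _; rewrite mxE sqrrN.
have ray0 u : [set mu : R | P (w + mu *: u)] 0 by rewrite /= scale0r addr0.
have b0 : 0 <= reach P w (- v) by apply: ub_le_sup; [exact: ray_bnd | exact: ray0].
have ab : reach P w v <= (e^-1 - 1) * reach P w (- v).
  apply: ge_sup; first by exists 0; exact: ray0.
  move=> mu /= Pmu; have [y Py wE] := P_w _ Pmu.
  have : e / (1 - e) * mu <= reach P w (- v).
    apply: ub_le_sup; first exact: ray_bnd.
    rewrite /=; suff -> : w + (e / (1 - e) * mu) *: - v = y by [].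
    have e2 : 1 - e != 0 by rewrite subr_eq0 gt_eqF.
    apply: (scalerI e2); apply/rowP => i; move/rowP/(_ i): wE.
    rewrite !mxE => wi; have -> : (1 - e) * y ord0 i = w ord0 i - e * (w ord0 i + mu * v ord0 i).
      by rewrite {1}wi; ring.
    by field.
  have -> : e^-1 - 1 = (e / (1 - e))^-1 by field; rewrite subr_eq0 !gt_eqF.
  by rewrite ler_pdivlMl // divr_gt0 // subr_gt0.
(* If the denominator is 0, the quotient is 0 by convention. *)
move: b0; rewrite le_eqVlt => /predU1P[<-|b0]; last by rewrite ler_pdivrMr.
by rewrite invr0 mulr0 subr_ge0 invf_ge1 // ltW.
Qed.

(** * Weights adapted to a large simplex *)

Lemma interior_row_full (R : realType) (d n : nat) (V : 'I_n -> 'rV[R]_d) w :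
  interior (conv_hull V) w -> row_full (\matrix_j homogenize (V j)).
Proof.
(* Full rank means K = 0. K annihilates the homogenized points of the hull, which contains a segment
   through w in every direction, so K annihilates every vector. *)
set A := \matrix_j _ => w_int; pose K := cokermx A.
have AK : A *m K = 0 by exact: mulmx_coker.
have PK x : conv_hull V x -> homogenize x *m K = 0.
  move=> [a [_ a1 xE]]; have /homogenize_combination -> := conj a1 xE.
  rewrite mulmx_suml big1 // => j _.
  rewrite -scalemxAl -[homogenize _](rowK (fun j => homogenize (V j))) -/A.
  by rewrite -row_mul AK row0 scaler0.
have Pw := interior_subset w_int.
have dirK v : row_mx v (0 : 'rV[R]_1) *m K = 0.
  have [e e0 /(_ e)] := interior_segment v w_int.
  rewrite gtr0_norm // => /(_ (lexx _)) /PK.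
  have -> : homogenize (w + e *: v) = homogenize w + e *: row_mx v (0 : 'rV[R]_1).
    by rewrite scale_row_mx scaler0 add_row_mx addr0.
  rewrite mulmxDl PK // add0r -scalemxAl => /eqP.
  by rewrite scaler_eq0 gt_eqF //= => /eqP.
have uK (u : 'rV[R]_(d + 1)) : u *m K = 0.
  have -> : u = rsubmx u 0 0 *: homogenize w +
      row_mx (lsubmx u - rsubmx u 0 0 *: w) (0 : 'rV[R]_1).
    rewrite scale_row_mx add_row_mx addr0 addrC subrK scalemx1 -mx11_scalar.
    by rewrite hsubmxK.
  by rewrite mulmxDl dirK addr0 -scalemxAl PK // scaler0.
have K0 : K = 0 by apply/row_matrixP => i; rewrite rowE uK row0.
have := mxrank_coker A; rewrite -/K K0 mxrank0 => /esym/eqP.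
by rewrite subn_eq0 => h; rewrite /row_full eqn_leq rank_leq_col h.
Qed.

(* A simplex of maximal volume among those spanned by the generators: by
   Cramer's rule no point has a barycentric coordinate exceeding 1. *)
Lemma large_simplex (R : realType) (d n : nat) (V : 'I_n -> 'rV[R]_d) w :
  interior (conv_hull V) w ->
  exists f : 'I_(d + 1) -> 'I_n, injective f /\
    forall x, conv_hull V x -> exists b : 'I_(d + 1) -> R,
      [/\ forall k, b k <= 1, \sum_k b k = 1 & x = \sum_k b k *: V (f k)].
Proof.
move=> /interior_row_full /max_det_rows[f [f_inj [B [BE B1]]]].
exists f; split=> // x [a [a0 a1 xE]].
exists (fun k => \sum_j a j * B j k).
have H : homogenize x = \sum_k (\sum_j a j * B j k) *: homogenize (V (f k)).
  have /homogenize_combination -> := conj a1 xE.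
  under [RHS]eq_bigr do rewrite scaler_suml.
  rewrite exchange_big /=; apply: eq_bigr => j _.
  have -> : homogenize (V j) = \sum_k B j k *: homogenize (V (f k)).
    have := congr1 (row j) BE; rewrite rowK => <-.
    rewrite row_mul mulmx_sum_row; apply: eq_bigr => k _.
    by rewrite mxE row_rowsub rowK.
  by rewrite scaler_sumr; apply: eq_bigr => k _; rewrite scalerA.
have [b1 xb] := (homogenize_combination _ _ _).1 H.
split=> // k; rewrite -a1; apply: ler_sum => j _.
by rewrite ler_piMr // (le_trans (ler_norm _)).
Qed.

(** With c the barycentre of the simplex, w = (y + e c) / (1 + e) for some y in the hull.
    Caratheodory in dimension d + 1 with c marked keeps c and at most d generators; the d + 1
    vertices of the simplex bring the total to 2d + 1. *)
Lemma positive_weights (R : realType) (d n : nat) (V : 'I_n -> 'rV[R]_d) w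
    (f : 'I_(d + 1) -> 'I_n) :
  interior (conv_hull V) w -> injective f ->
  exists a : 'I_n -> R, [/\ forall j, 0 <= a j, forall k, 0 < a (f k),
    \sum_j a j = 1, w = \sum_j a j *: V j & (#|[set j | a j != 0%R]%SET| <= 2 * d + 1)%N].
Proof.
move=> w_int f_inj.
pose s : R := (d + 1)%:R^-1.
have s0 : 0 < s by rewrite invr_gt0 ltr0n addn1.
pose c := \sum_k s *: V (f k).
have [e e0 eP] := interior_segment (w - c) w_int.
have [a [a0 a1 yE]] : conv_hull V (w + e *: (w - c)).
  by apply: eP; rewrite gtr0_norm.
have e1 : 0 < 1 + e by lra.
pose U (i : 'I_n.+1) := if unlift ord0 i is Some j then homogenize (V j) else homogenize c.
pose a' (i : 'I_n.+1) := (1 + e)^-1 * if unlift ord0 i is Some j then a j else e.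
have Uc i : U i *m col_mx 0 1%:M = 1%:M.
  by rewrite /U; case: unlift => [j|]; rewrite mul_row_col mulmx0 mulmx1 add0r.
have [||b [b0 b_c b_sum b_card]] := caratheodory_marked (a := a') (i0 := ord0) Uc.
- move=> i; apply: mulr_ge0; first by rewrite invr_ge0 ltW.
  by case: unlift => [j|]; rewrite ?a0 // ltW.
- by rewrite /a' unlift_none mulr_gt0 ?invr_gt0.
(* The weight of c, which has index [ord0], is spread equally over the vertices of the simplex. *)
pose a2 j := b (lift ord0 j) + (b ord0 * s) *+ (j \in codom f).
have hw : homogenize w = \sum_i b i *: U i.
  rewrite b_sum big_ord_recl /a' /U unlift_none.
  under eq_bigr do rewrite liftK -scalerA.
  rewrite -scaler_sumr; have /homogenize_combination <- := conj a1 yE.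
  rewrite -scalerA -scalerDr scale_row_mx add_row_mx.
  apply: (canRL (scalerK _)); first by rewrite gt_eqF.
  rewrite scale_row_mx; congr row_mx.
    by apply/rowP => i; rewrite !mxE; ring.
  by rewrite scalerDl scale1r addrC.
have hc : homogenize c = \sum_j (s *+ (j \in codom f)) *: homogenize (V j).
  have -> : homogenize c = \sum_k s *: homogenize (V (f k)).
    apply/(homogenize_combination (fun=> s)); split=> //.
    by rewrite sumr_const card_ord -[_ *+ _]mulr_natl divff // pnatr_eq0 addn1.
  rewrite (bigID (mem (codom f))) /= [X in _ + X]big1 ?addr0; last first.
    by move=> j /negPf ->; rewrite scale0r.
  rewrite (eq_bigr (fun j => s *: homogenize (V j))); last first.
    by move=> j jf; rewrite (jf : j \in codom f).
  rewrite -big_uniq ?big_map ?big_enum //=.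
  by rewrite map_inj_uniq ?enum_uniq.
have {hw hc} : homogenize w = \sum_j a2 j *: homogenize (V j).
  rewrite hw big_ord_recl /U unlift_none hc scaler_sumr -big_split /=.
  apply: eq_bigr => j _; rewrite liftK scalerA -scalerDl /a2.
  by rewrite addrC mulrnAr.
case/homogenize_combination => a21 wE.
exists a2; split=> //.
- by move=> j; rewrite addr_ge0 // mulrn_wge0 // mulr_ge0 // ltW.
- move=> k; rewrite /a2 codom_f mulr1n ltr_wpDl // mulr_gt0 //.
- pose S : {set 'I_n} := [set j | b (lift ord0 j) != 0%R]%SET.
  have S_card : (#|S| <= d)%N.
    rewrite -ltnS -(addn1 d); apply: leq_trans b_card.
    rewrite -(card_imset _ (@lift_inj _ (@ord0 n))).
    apply: proper_card; apply/properP; split.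
      by apply/fintype.subsetP => _ /imsetP[j + ->]; rewrite !inE.
    exists ord0; first by rewrite inE gt_eqF.
    by apply/negP => /imsetP[j _ /eqP]; rewrite (negPf (neq_lift _ _)).
  pose S' := (S :|: [set f k | k : 'I_(d + 1)])%SET.
  have : (#|[set j | a2 j != 0%R]%SET| <= #|S'|)%N.
    apply: subset_leq_card; apply/fintype.subsetP => j; rewrite !inE /a2.
    apply: contraNT; rewrite negb_or negbK => /andP[/eqP -> jf].
    rewrite add0r (_ : j \in codom f = false) //.
    by apply: contraNF jf => /codomP[k ->]; rewrite imset_f ?inE.
  move/leq_trans; apply; rewrite (leq_trans (leq_card_setU _ _)) //.
  rewrite mulSn mul1n -addnA leq_add //.
  by rewrite (leq_trans (leq_imset_card _ _)) // card_ord.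
Qed.

(** The remaining weights are nonnegative since e b_k <= e <= a_k, even where b_k is negative;
    dividing them by 1 - e gives y. *)
Lemma extract_weight (R : realType) (d m p : nat) (W : 'I_m -> 'rV[R]_d)
    (a : 'I_m -> R) (g : 'I_p -> 'I_m) (b : 'I_p -> R) (e : R) :
  injective g -> 0 <= e < 1 -> (forall k, e <= a k) -> \sum_k a k = 1 ->
  (forall k, b k <= 1) -> \sum_k b k = 1 ->
  exists2 y, conv_hull W y &
    \sum_k a k *: W k = e *: (\sum_k b k *: W (g k)) + (1 - e) *: y.
Proof.
move=> g_inj /andP[e0 e1] ae a1 b1 bs.
have e2 : 1 - e != 0 by rewrite subr_eq0 gt_eqF.
(* The weights b transported along g, with value 0 off its image. *)
pose b' k := \sum_(k' | g k' == k) b k'.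
have b'1 k : b' k <= 1.
  rewrite /b'; have [[k' <-]|kg] := pselect (exists k', g k' = k).
    rewrite (big_pred1 k') // => k2; exact: inj_eq.
  by rewrite big_pred0 // => k'; apply/negP => /eqP h; apply: kg; exists k'.
have b's : \sum_k b' k = 1.
  by rewrite -[RHS]bs [RHS](partition_big g xpredT).
have b'W : \sum_k b k *: W (g k) = \sum_k b' k *: W k.
  rewrite (partition_big g xpredT) //=; apply: eq_bigr => k _.
  by rewrite scaler_suml; apply: eq_bigr => k' /eqP ->.
exists (\sum_k ((a k - e * b' k) / (1 - e)) *: W k).
  exists (fun k => (a k - e * b' k) / (1 - e)); split=> //.
  - move=> k; rewrite divr_ge0 ?subr_ge0 ?(ltW e1) //.
    by apply: le_trans (ae k); rewrite ler_piMr.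
  - by rewrite -mulr_suml sumrB -mulr_sumr a1 b's mulr1 divff.
rewrite b'W !scaler_sumr -big_split /=; apply: eq_bigr => k _.
rewrite !scalerA -scalerDl; congr (_ *: _); by field.
Qed.

(** * Lattice points with balanced weights *)

Lemma set_enumeration (T : finType) (K : {set T}) :
  exists e : 'I_#|K| -> T, [/\ injective e, forall j, j \in K -> exists k, e k = j &
    forall k, e k \in K].
Proof.
exists enum_val; split; [exact: enum_val_inj| |exact: enum_valP].
by move=> j jK; exists (enum_rank_in jK j); rewrite enum_rankK_in.
Qed.

Lemma sum_supported (R : realType) (M : lmodType R) (m n : nat) (e : 'I_m -> 'I_n)
    (a : 'I_n -> R) (V : 'I_n -> M) :
  injective e -> (forall j, a j != 0 -> exists k, e k = j) ->
  \sum_j a j *: V j = \sum_k a (e k) *: V (e k).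
Proof.
move=> e_inj e_onto; rewrite (bigID (mem (codom e))) /= [X in _ + X]big1 ?addr0.
  by rewrite -big_uniq ?big_map ?big_enum //= map_inj_uniq ?enum_uniq.
move=> j jK; have [->|/e_onto[k kj]] := eqVneq (a j) 0; first by rewrite scale0r.
by rewrite -kj codom_f in jK.
Qed.

(** The new point is (1 + l q) times the old one minus l times the integral point with coefficients
    m_k. *)
Lemma in_lattice_step (R : realType) (d n l : nat) (V : 'I_n -> 'rV[R]_d)
    (a : 'I_n -> R) (q : nat) (m : 'I_n -> int) :
  (forall i, in_lattice 1 (V i)) -> in_lattice l (\sum_k a k *: V k) ->
  in_lattice l (\sum_k (a k + l%:R * (q%:R * a k - (m k)%:~R)) *: V k).
Proof.
move=> VZ aL i; have [z zE] := aL i.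
have /choice[v vE] : forall k, exists z : int, V k ord0 i = z%:~R.
  by move=> k; have [y ->] := VZ k i; exists (1 * y).
exists ((1 + l%:Z * q%:Z) * z - \sum_k m k * v k).
rewrite summxE; rewrite summxE in zE.
have -> : \sum_k ((a k + l%:R * (q%:R * a k - (m k)%:~R)) *: V k) ord0 i =
   (1 + l%:R * q%:R) * (\sum_k (a k *: V k) ord0 i) - l%:R * \sum_k (m k)%:~R * (v k)%:~R.
  rewrite !mulr_sumr -sumrB; apply: eq_bigr => k _; rewrite !mxE -vE; ring.
rewrite zE !rmorphM rmorphB /= !rmorphM rmorphD /= rmorphM rmorph_sum /=.
under [\sum_k (m k * v k)%:~R]eq_bigr do rewrite rmorphM.
by rewrite -!pmulrn /=; ring.
Qed.

(** It suffices that 64 l <= (8l+7)^2, since 2^(2d+1) = 2 * 2^(2d), and that 8d >= 1. *)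
Lemma threshold_inv_le (R : realType) (d l : nat) : (0 < d)%N -> (0 < l)%N ->
  (threshold R l (2 * d))^-1 <= 8 * d%:R * (8 * l%:R + 7) ^+ (2 ^ (2 * d + 1))%N.
Proof.
move=> d0 l0.
have l1 : 1 <= l%:R :> R by rewrite ler1n.
have d1 : 1 <= d%:R :> R by rewrite ler1n.
have x0 : 0 < (64 * l%:R) ^+ (2 ^ (2 * d))%N :> R by rewrite exprn_gt0 // mulr_gt0 // ltr0n.
apply: (@le_trans _ _ ((64 * l%:R) ^+ (2 ^ (2 * d))%N)).
  rewrite -[leRHS]invrK lef_pV2 ?posrE ?threshold_gt0 ?invr_gt0 //.
  exact: threshold_ge.
rewrite addn1 expnS exprM.
apply: (@le_trans _ _ (((8 * l%:R + 7) ^+ 2) ^+ (2 ^ (2 * d))%N)).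
  by rewrite lerXn2r ?nnegrE //; nra.
by rewrite ler_peMl ?exprn_ge0 //; nra.
Qed.

Theorem theorem4 (R : realType) (d l : nat) (P : set 'rV[R]_d) :
  (1 <= l)%N ->
  lattice_polytope P ->
  interior_lattice_points l P !=set0 ->
  exists2 w : 'rV[R]_d, interior_lattice_points l P w &
    (ca w P <=
      (8 * d%:R * (8 * l%:R + 7) ^+ (2 ^ (2 * d + 1))%N - 1 : R)%:E)%E.
Proof.
move=> l0 [P_poly P_lat] [w0 [w0_int w0_l]].
(* In dimension 0 there is no unit vector: the supremum is over the empty set, and the bound is
   -1. *)
have [d0|d0] := posnP d.
  exists w0 => //; apply: ge_ereal_sup => _ [v v1 <-]; move: v1; rewrite /= /enorm.
  rewrite big1 => [|i _]; last by have := ltn_ord i; rewrite [X in (_ < X)%N]d0.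
  by rewrite sqrtr0 => /eqP; rewrite eq_sym oner_eq0.
have [n [V [PE V_vert]]] := polytope_vertices P_poly.
have VZ i : in_lattice 1 (V i) by exact: P_lat.
rewrite {}PE in w0_int *.
have [f [f_inj f_bary]] := large_simplex w0_int.
have [a [a0 af a1 wE aK]] := positive_weights w0_int f_inj.
have [e [e_inj e_onto eK]] := set_enumeration [set j | a j != 0%R]%SET.
have {}e_onto j : a j != 0 -> exists k, e k = j by move=> aj; apply: e_onto; rewrite inE.
have {}eK k : a (e k) != 0 by have := eK k; rewrite inE.
have /choice[g gE] : forall k, exists k', e k' = f k.
  by move=> k; apply: e_onto; rewrite gt_eqF.
(* The number of vertices in use is positive, because those of the simplex occur; it is written m +
   1. *)
case: #|_| aK e e_inj e_onto eK g gE => [|m] aK e e_inj e_onto eK g gE.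
  by case: (g (rshift d ord0)).
have g_inj : injective g by move=> k1 k2 gk; apply: f_inj; rewrite -!gE gk.
have [||||b [bL b1 b_ge]] := @balanced_weights R m l
    (fun b => in_lattice l (\sum_k b k *: V (e k))) (a \o e) l0.
- by move=> b q c bL _; apply: in_lattice_step.
- by rewrite -(sum_supported V) // -wE.
- by move=> k; rewrite /= lt_neqAle eq_sym eK a0.
(* The sum of the weights is treated as a combination of the constant vector 1, so that
   [sum_supported] applies. *)
- transitivity (\sum_k a (e k) *: (1 : R^o)).
    by apply: eq_bigr => k _; exact/esym/mulr1.
  rewrite -(sum_supported (fun=> 1 : R^o) e_inj e_onto) -[RHS]a1.
  by apply: eq_bigr => j _; exact: mulr1.
pose eps := threshold R l (2 * d).
have eps0 : 0 < eps by apply: threshold_gt0.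
have eps1 : eps < 1.
  have : eps <= threshold R l 1 by apply: threshold_le => //; rewrite muln_gt0.
  have := thresholdS_le R 0 l0; rewrite threshold0 //; lra.
(* At most 2d + 1 vertices are used, so m <= 2d and T_2d <= T_m. *)
have {}b_ge k : eps <= b k.
  apply: le_trans (b_ge k); apply: threshold_le => //; lia.
set w := \sum_k b k *: V (e k) in bL.
have w_split x : conv_hull V x -> exists2 y, conv_hull V y & w = eps *: x + (1 - eps) *: y.
  move=> /f_bary[c [c1 cs ->]].
  have eps01 : 0 <= eps < 1 by rewrite ltW.
  have [y yW yE] := extract_weight (V \o e) g_inj eps01 b_ge b1 c1 cs.
  exists y; first by apply: conv_hull_sub yW => j; exact: conv_hull_mem.
  by rewrite /w yE; under [in LHS]eq_bigr do rewrite /= gE.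
(* Splitting off the interior point w0 with positive weight makes w interior. *)
have w_int : interior (conv_hull V) w.
  have [y yP ->] := w_split _ (interior_subset w0_int).
  apply: interior_homothety => //; last by rewrite eps0 ltW.
  by move=> u v t; exact: conv_hull_convex.
exists w => //.
apply: (@le_trans _ _ (eps^-1 - 1)%:E).
  apply: ca_le => //; [exact: conv_hull_bounded | by rewrite eps0 | exact: interior_subset].
by rewrite lee_fin lerB // threshold_inv_le.
Qed.
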